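(* The free diffeological vector space $F(\mathbb{R})$ generated by $\mathbb{R}$ (with its standard diffeology) is not in $\mathcal{DV}$; that is, its diffeology is not determined by its smooth linear functionals.
   Context: A diffeological space is a set $X$ together with a specified set of functions $U\to X$ (called plots) for each open set $U\subseteq\mathbb{R}^n$ and each $n\in\mathbb{N}$, such that: (1) every constant function $U\to X$ is a plot; (2) if $U\to X$ is a plot and $V\to U$ is smooth ($V$ open in some $\mathbb{R}^m$), then the composite $V\to U\to X$ is a plot; (3) if $U=\bigcup_i U_i$ is an open cover and $U\to X$ is a function each of whose restrictions $U_i\to X$ is a plot, then $U\to X$ is a plot. A function $f:X\to Y$ between diffeological spaces is smooth if $f\circ p$ is a plot of $Y$ for every plot $p$ of $X$. $\mathbb{R}^n$ carries the standard diffeology (plots are the usual smooth maps). Products carry the product diffeology (plots are the functions all of whose components are plots). A diffeological vector space is a real vector space $V$ with a diffeology such that addition $V\times V\to V$ and scalar multiplication $\mathbb{R}\times V\to V$ are smooth. The free diffeological vector space $F(X)$ generated by a diffeological space $X$ is the real vector space with basis the elements of $X$, equipped with the smallest (fewest plots) diffeology making it a diffeological vector space and such that the natural map $X\to F(X)$ is smooth. $\mathcal{DV}$ is the collection of diffeological vector spaces $V$ whose diffeology is determined by the smooth linear functionals: a function $p:U\to V$ ($U$ open in some $\mathbb{R}^n$) is a plot if and only if $\ell\circ p:U\to\mathbb{R}$ is smooth for every smooth linear functional $\ell:V\to\mathbb{R}$. *)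

(* Defs.v *)
From HB Require Import structures.
From mathcomp Require Import freeg.
From mathcomp Require Import all_boot all_order all_algebra.
From mathcomp Require Import all_classical all_reals all_analysis.

Set Implicit Arguments.
Unset Strict Implicit.
Unset Printing Implicit Defensive.

Import Order.TTheory GRing.Theory Num.Theory.
Import numFieldNormedType.Exports.

Local Open Scope classical_set_scope.
Local Open Scope ring_scope.

Section SmoothMaps.
Context {R : realType}.

(* A map U -> W on an open U is given by a total function f, of which only the
   values on U matter: since U is open, continuity, differentiability and
   directional derivatives at a point of U depend on f only through its
   restriction to U. *)
Fixpoint Ck (k : nat) n (W : normedModType R) (U : set 'rV[R]_n)
    (f : 'rV[R]_n -> W) : Prop :=
  if k is k'.+1 then
    (forall x, U x -> differentiable f x) /\
    (forall v : 'rV[R]_n, Ck k' U ('D_v f))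
  else forall x, U x -> {for x, continuous f}.

Definition smooth_on n (W : normedModType R) (U : set 'rV[R]_n)
    (f : 'rV[R]_n -> W) : Prop :=
  forall k, Ck k U f.

Lemma CkW k n (W : normedModType R) (U : set 'rV[R]_n) (f : 'rV[R]_n -> W) :
  Ck k.+1 U f -> Ck k U f.
Proof.
elim: k f => [|k IHk] f [df Df].
  by move=> x Ux; apply: differentiable_continuous; exact: df.
by split => // v; apply: IHk; exact: Df.
Qed.

Lemma near_open_eq (V W : normedModType R) (U : set V) (f g : V -> W) (x : V) :
  open U -> (forall y, U y -> f y = g y) -> U x -> {near x, f =1 g}.
Proof.
by move=> oU fg Ux; move: (open_nbhs_nbhs (conj oU Ux)); apply: filterS.
Qed.

Lemma near_eq_continuous (V W : normedModType R) (f g : V -> W) (x : V) :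
  {near x, f =1 g} -> {for x, continuous f} -> {for x, continuous g}.
Proof.
move=> fg; rewrite /prop_for /continuous_at -(nbhs_singleton fg).
by apply: cvg_trans; apply: near_eq_cvg; move: fg; apply: filterS.
Qed.

Lemma near_eq_differentiable (V W : normedModType R) (f g : V -> W) (x : V) :
  {near x, f =1 g} -> differentiable f x -> differentiable g x.
Proof.
move=> fg /diff_locallyP[cdf fE].
have gE : g \o shift x = cst (g x) + 'd f x +o_ 0 id.
  move: fE => /eqaddoP fE; apply/eqaddoP => e e0.
  have fg0 : \forall y \near (0 : V), f (y + x) = g (y + x).
    move: fg; rewrite (near_shift 0 x) subr0; exact.
  have fgx := nbhs_singleton fg.
  move: (fE e e0); apply: filter_app; near=> y.
  have fgy : f (y + x) = g (y + x) by near: y.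
  by rewrite -fgx; rewrite /= !fctE /= fgy.
have dfg := diff_unique cdf gE.
by apply/diff_locallyP; rewrite dfg.
Unshelve. all: by end_near.
Qed.

Lemma Ck_ext k n (W : normedModType R) (U : set 'rV[R]_n)
    (f g : 'rV[R]_n -> W) :
  open U -> (forall x, U x -> f x = g x) -> Ck k U f -> Ck k U g.
Proof.
move=> oU; elim: k f g => [|k IHk] f g fg.
  by move=> cf x Ux; apply: near_eq_continuous (cf x Ux); exact: near_open_eq Ux.
move=> [df Df]; have fgx (x : 'rV[R]_n) : U x -> {near x, f =1 g}.
  exact: near_open_eq.
split=> [x Ux|v].
  by apply: near_eq_differentiable (df x Ux); exact: fgx.
apply: IHk (Df v) => x Ux.
by apply: near_eq_derive; exact: fgx.
Qed.

Lemma Ck_cst k n (W : normedModType R) (U : set 'rV[R]_n) (a : W) :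
  Ck k U (fun=> a).
Proof.
elim: k a => [|k IHk] a; first by move=> x _; exact: cst_continuous.
split=> [x _|v]; first exact: differentiable_cst.
rewrite (_ : 'D_v _ = (fun=> 0)); first exact: IHk.
by apply/funext => x; exact: derive_cst.
Qed.

Lemma CkD k n (W : normedModType R) (U : set 'rV[R]_n) (f g : 'rV[R]_n -> W) :
  open U -> Ck k U f -> Ck k U g -> Ck k U (fun x => f x + g x).
Proof.
move=> oU; elim: k f g => [|k IHk] f g.
  by move=> cf cg x Ux; apply: continuousD; [exact: cf|exact: cg].
move=> [df Df] [dg Dg]; split=> [x Ux|v].
  by apply: differentiableD; [exact: df|exact: dg].
apply: (Ck_ext (f := fun x => 'D_v f x + 'D_v g x)) => // [x Ux|].
  by rewrite -deriveD //; apply: diff_derivable; [exact: df|exact: dg].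
by apply: IHk; [exact: Df|exact: Dg].
Qed.

Lemma CkM k n (U : set 'rV[R]_n) (f g : 'rV[R]_n -> R) :
  open U -> Ck k U f -> Ck k U g -> Ck k U (fun x => f x * g x).
Proof.
move=> oU; elim: k f g => [|k IHk] f g.
  by move=> cf cg x Ux; apply: continuousM; [exact: cf|exact: cg].
move=> Cf Cg; have [df Df] := Cf; have [dg Dg] := Cg; split=> [x Ux|v].
  by apply: differentiableM; [exact: df|exact: dg].
apply: (Ck_ext (f := fun x => f x * 'D_v g x + g x * 'D_v f x)) => // [x Ux|].
  rewrite (_ : (fun x => f x * g x) = f * g) // deriveM //.
  - by apply: diff_derivable; exact: df.
  - by apply: diff_derivable; exact: dg.
by apply: CkD => //; apply: IHk => //; by [exact: CkW|exact: Df|exact: Dg].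
Qed.

Lemma Ck_sum k n (U : set 'rV[R]_n) m (f : 'I_m -> 'rV[R]_n -> R) :
  open U -> (forall i, Ck k U (f i)) -> Ck k U (fun x => \sum_i f i x).
Proof.
move=> oU; elim: m f => [|m IHm] f Cf.
  rewrite (_ : (fun x => _) = (fun=> 0)); first exact: Ck_cst.
  by apply/funext => x; rewrite big_ord0.
rewrite (_ : (fun x => _) = (fun x => f ord0 x + \sum_i f (lift ord0 i) x)).
  by apply: CkD => //; exact: IHm.
by apply/funext => x; rewrite big_ord_recl.
Qed.

Lemma Ck_coord k n m (U : set 'rV[R]_n) (g : 'rV[R]_n -> 'rV[R]_m) i :
  open U -> Ck k U g -> Ck k U (fun x => g x ord0 i).
Proof.
move=> oU; elim: k g => [|k IHk] g.
  move=> cg x Ux; apply: (@continuous_comp _ _ _ g (fun M : 'rV[R]_m => M ord0 i)).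
    exact: cg.
  exact: coord_continuous.
move=> [dg Dg]; split=> [x Ux|v].
  apply: (@differentiable_comp _ _ _ _ g (fun M : 'rV[R]_m => M ord0 i)).
    exact: dg.
  exact: differentiable_coord.
apply: (Ck_ext (f := fun x => 'D_v g x ord0 i)) => // [x Ux|]; last exact/IHk/Dg.
by rewrite derive_mx ?mxE//; apply: diff_derivable; exact: dg.
Qed.

Lemma Ck_comp k n m (U : set 'rV[R]_n) (V : set 'rV[R]_m)
    (p : 'rV[R]_n -> R) (g : 'rV[R]_m -> 'rV[R]_n) :
  open V -> (forall x, V x -> U (g x)) ->
  Ck k U p -> Ck k V g -> Ck k V (p \o g).
Proof.
move=> oV gU; elim: k p => [|k IHk] p.
  by move=> cp cg x Vx; apply: continuous_comp; [exact: cg|exact/cp/gU].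
move=> [dp Dp] Cg; have [dg Dg] := Cg; split=> [x Vx|v].
  by apply: differentiable_comp; [exact: dg|exact/dp/gU].
pose h x := \sum_i ('D_v g x ord0 i * ('D_(delta_mx ord0 i) p \o g) x).
apply: (Ck_ext (f := h)) => // [x Vx|].
  have dgx := dg x Vx; have dpx := dp _ (gU x Vx).
  rewrite deriveE; last exact: differentiable_comp.
  rewrite diff_comp //= -(deriveE v dgx) /h.
  rewrite [in RHS](row_sum_delta ('D_v g x)) linear_sum.
  by apply: eq_bigr => i _; rewrite linearZ /= -deriveE.
apply: Ck_sum => // i; apply: CkM => //.
  by apply: Ck_coord => //; exact: Dg.
by apply: IHk; [exact: Dp|exact: CkW].
Qed.

End SmoothMaps.

Section Diffeology.
Context {R : realType}.

(* [plot D U p] means that the restriction of p to the open set U is a plot.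
   Plots are total functions, constrained only on U (see [plot_ext]); no
   function U -> X is lost, because it extends to a total one as soon as X is
   inhabited, and when X is empty the only plot is the one from the empty set. *)
Record diffeology (X : Type) := Diffeology {
  plot : forall n, set 'rV[R]_n -> ('rV[R]_n -> X) -> Prop;
  plot_open : forall n (U : set 'rV[R]_n) p, plot U p -> open U;
  plot_ext : forall n (U : set 'rV[R]_n) p q,
    (forall x, U x -> p x = q x) -> plot U p -> plot U q;
  plot_cst : forall n (U : set 'rV[R]_n) (a : X),
    open U -> plot U (fun=> a);
  plot_comp : forall m n (V : set 'rV[R]_m) (U : set 'rV[R]_n) g p,
    open V -> smooth_on V g -> (forall x, V x -> U (g x)) ->
    plot U p -> plot V (p \o g);
  plot_cover : forall n (I : Type) (U_ : I -> set 'rV[R]_n) p,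
    (forall i, plot (U_ i) p) -> plot (\bigcup_i U_ i) p
}.

Definition dsmooth (X Y : Type) (DX : diffeology X) (DY : diffeology Y)
    (f : X -> Y) : Prop :=
  forall n (U : set 'rV[R]_n) p, plot DX U p -> plot DY U (f \o p).

Section Product.
Context (X Y : Type) (DX : diffeology X) (DY : diffeology Y).

Definition prod_plot n (U : set 'rV[R]_n) (p : 'rV[R]_n -> X * Y) : Prop :=
  plot DX U (fst \o p) /\ plot DY U (snd \o p).

Lemma prod_plot_open n (U : set 'rV[R]_n) p : prod_plot U p -> open U.
Proof. by case=> /plot_open. Qed.

Lemma prod_plot_ext n (U : set 'rV[R]_n) p q :
  (forall x, U x -> p x = q x) -> prod_plot U p -> prod_plot U q.
Proof.
move=> pq [p1 p2]; split.
- by apply: plot_ext p1 => x Ux /=; rewrite pq.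
- by apply: plot_ext p2 => x Ux /=; rewrite pq.
Qed.

Lemma prod_plot_cst n (U : set 'rV[R]_n) (a : X * Y) :
  open U -> prod_plot U (fun=> a).
Proof. by move=> oU; split; exact: plot_cst. Qed.

Lemma prod_plot_comp m n (V : set 'rV[R]_m) (U : set 'rV[R]_n) g p :
  open V -> smooth_on V g -> (forall x, V x -> U (g x)) ->
  prod_plot U p -> prod_plot V (p \o g).
Proof.
move=> oV sg gU [p1 p2]; split.
- exact: plot_comp oV sg gU p1.
- exact: plot_comp oV sg gU p2.
Qed.

Lemma prod_plot_cover n (I : Type) (U_ : I -> set 'rV[R]_n) p :
  (forall i, prod_plot (U_ i) p) -> prod_plot (\bigcup_i U_ i) p.
Proof. by move=> pp; split; apply: plot_cover => i; have [] := pp i. Qed.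

Definition prod_diffeology : diffeology (X * Y) :=
  Diffeology prod_plot_open prod_plot_ext prod_plot_cst prod_plot_comp
    prod_plot_cover.

End Product.

Section Real.

Definition real_plot n (U : set 'rV[R]_n) (p : 'rV[R]_n -> R) : Prop :=
  open U /\ smooth_on U p.

Lemma real_plot_open n (U : set 'rV[R]_n) p : real_plot U p -> open U.
Proof. by case. Qed.

Lemma real_plot_ext n (U : set 'rV[R]_n) p q :
  (forall x, U x -> p x = q x) -> real_plot U p -> real_plot U q.
Proof. by move=> pq [oU sp]; split=> // k; exact: Ck_ext oU pq (sp k). Qed.

Lemma real_plot_cst n (U : set 'rV[R]_n) (a : R) :
  open U -> real_plot U (fun=> a).
Proof. by move=> oU; split=> // k; exact: Ck_cst. Qed.

Lemma real_plot_comp m n (V : set 'rV[R]_m) (U : set 'rV[R]_n) g p :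
  open V -> smooth_on V g -> (forall x, V x -> U (g x)) ->
  real_plot U p -> real_plot V (p \o g).
Proof.
by move=> oV sg gU [oU sp]; split=> // k; exact: Ck_comp oV gU (sp k) (sg k).
Qed.

Lemma real_plot_cover n (I : Type) (U_ : I -> set 'rV[R]_n) p :
  (forall i, real_plot (U_ i) p) -> real_plot (\bigcup_i U_ i) p.
Proof.
move=> pp; split; first by apply: bigcup_open => i _; have [] := pp i.
move=> k; have {pp} : forall i, Ck k (U_ i) p by move=> i; have [] := pp i.
elim: k p => [|k IHk] p Cp; first by move=> x [i _ Ux]; exact: (Cp i).
split=> [x [i _ Ux]|v]; first by have [dp _] := Cp i; exact: dp.
by apply: IHk => i; have [_] := Cp i; exact.
Qed.

Definition real_diffeology : diffeology R :=
  Diffeology real_plot_open real_plot_ext real_plot_cst real_plot_comp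
    real_plot_cover.

End Real.

Section DiffeologicalVectorSpace.

Definition is_dvs (V : lmodType R) (D : diffeology V) : Prop :=
  dsmooth (prod_diffeology D D) D (fun u => u.1 + u.2) /\
  dsmooth (prod_diffeology real_diffeology D) D (fun u => u.1 *: u.2).

Record dvs := Dvs {
  dvs_sort :> lmodType R;
  dvs_diffeology : diffeology dvs_sort;
  dvsP : is_dvs dvs_diffeology
}.

Definition in_DV (V : dvs) : Prop :=
  forall n (U : set 'rV[R]_n) (p : 'rV[R]_n -> V), open U ->
    (plot (dvs_diffeology V) U p <->
     forall l : {scalar V}, dsmooth (dvs_diffeology V) real_diffeology l ->
       smooth_on U (l \o p)).

End DiffeologicalVectorSpace.

Section Coarse.
Context (X : Type).

Let coarse_plot n (U : set 'rV[R]_n) (p : 'rV[R]_n -> X) : Prop := open U.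

Let coarse_cover n (I : Type) (U_ : I -> set 'rV[R]_n) p :
  (forall i, coarse_plot (U_ i) p) -> coarse_plot (\bigcup_i U_ i) p.
Proof. by move=> oU; apply: bigcup_open => i _; exact: oU. Qed.

Definition coarse_diffeology : diffeology X :=
  @Diffeology X coarse_plot (fun _ _ _ oU => oU) (fun _ _ _ _ _ oU => oU)
    (fun _ _ _ oU => oU) (fun _ _ _ _ _ _ oV _ _ _ => oV) coarse_cover.

End Coarse.

Lemma coarse_is_dvs (V : lmodType R) : is_dvs (coarse_diffeology V).
Proof. by split=> n U p [_] /plot_open. Qed.

Section Free.
Context (X : choiceType) (DX : diffeology X).

Definition free_unit (x : X) : {freeg X / R} := << x >>.

(* The smallest diffeology on the vector space with basis X that makes it a
   diffeological vector space and [free_unit] smooth, as an intersection. *)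
Definition free_plot n (U : set 'rV[R]_n) (p : 'rV[R]_n -> {freeg X / R}) :
    Prop :=
  forall D : diffeology {freeg X / R}, is_dvs D -> dsmooth DX D free_unit ->
    plot D U p.

Lemma free_plot_open n (U : set 'rV[R]_n) p : free_plot U p -> open U.
Proof.
move=> /(_ _ (coarse_is_dvs _)) pU; apply: plot_open (pU _).
by move=> m V q /plot_open.
Qed.

Lemma free_plot_ext n (U : set 'rV[R]_n) p q :
  (forall x, U x -> p x = q x) -> free_plot U p -> free_plot U q.
Proof. by move=> pq fp D vD uD; apply: plot_ext pq _; exact: fp. Qed.

Lemma free_plot_cst n (U : set 'rV[R]_n) a : open U -> free_plot U (fun=> a).
Proof. by move=> oU D vD uD; exact: plot_cst. Qed.

Lemma free_plot_comp m n (V : set 'rV[R]_m) (U : set 'rV[R]_n) g p :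
  open V -> smooth_on V g -> (forall x, V x -> U (g x)) ->
  free_plot U p -> free_plot V (p \o g).
Proof.
by move=> oV sg gU fp D vD uD; apply: plot_comp oV sg gU _; exact: fp.
Qed.

Lemma free_plot_cover n (I : Type) (U_ : I -> set 'rV[R]_n) p :
  (forall i, free_plot (U_ i) p) -> free_plot (\bigcup_i U_ i) p.
Proof. by move=> fp D vD uD; apply: plot_cover => i; exact: fp. Qed.

Definition free_diffeology : diffeology {freeg X / R} :=
  Diffeology free_plot_open free_plot_ext free_plot_cst free_plot_comp
    free_plot_cover.

Lemma free_unit_smooth : dsmooth DX free_diffeology free_unit.
Proof. by move=> n U p Xp D vD uD; exact: uD. Qed.

Lemma free_diffeology_min (D : diffeology {freeg X / R}) :
  is_dvs D -> dsmooth DX D free_unit ->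
  forall n (U : set 'rV[R]_n) p, plot free_diffeology U p -> plot D U p.
Proof. by move=> vD uD n U p; exact. Qed.

Lemma free_is_dvs : is_dvs free_diffeology.
Proof.
split=> n U p [p1 p2] D vD uD; have [vA vS] := vD.
- by apply: vA; split; [exact: p1|exact: p2].
- by apply: vS; split; [exact: p1|exact: p2].
Qed.

Definition free_dvs : dvs := Dvs free_is_dvs.

End Free.

End Diffeology.

Arguments diffeology R X : clear implicits.
Arguments dvs R : clear implicits.
Arguments real_diffeology R : clear implicits.

(* Main.v *)
Require Import Defs.
From mathcomp Require Import freeg.
From mathcomp Require Import all_boot all_order all_algebra.
From mathcomp Require Import all_classical all_reals all_analysis.
From mathcomp Require Import ring.

Set Implicit Arguments.
Unset Strict Implicit.
Unset Printing Implicit Defensive.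

Import Order.TTheory GRing.Theory Num.Theory.
Import numFieldNormedType.Exports.

Local Open Scope classical_set_scope.
Local Open Scope ring_scope.

(** A smooth linear functional on F(R) is integration of a smooth function f
    against finite combinations of point masses: it sends the sum of the
    r_i [x_i] to the sum of the r_i f(x_i).  Such functionals cannot tell how
    many points a combination involves when its coefficients are small enough;
    the free diffeology can.

    With e the flat function exp(-1/t) for t > 0 and 0 for t <= 0, the curve
    [witness] is

      p(t) = e(t) * sum over n of e(1/(n+1) - t) [1/(n+1)].

    For t > 0 the sum is finite, because the n-th term lives on t < 1/(n+1), and
    p(t) = 0 for t <= 0.

    - Every smooth functional l makes l o p smooth ([witness_smooth]).  With
      c_n = f(1/(n+1)), which is bounded since f is continuous at 0, one has
      l(p(t)) = e(t) G(t) where G(t) is the sum of the c_n e(1/(n+1) - t).  On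
      t > 0 the function G is smooth, and each of its derivatives is O(1/t) near
      0, being a sum of about 1/t nonzero terms that are uniformly bounded
      ([moderate_cascade]).  Multiplication by e turns such a function into a
      smooth function on the whole line ([ntimes_derivable_flat]).

    - The curve p is not a plot.  The maps into F(R) whose values have, locally,
      boundedly many points in their support form a vector space diffeology
      ([lbs_is_dvs]) for which R -> F(R) is smooth; the free diffeology being
      the smallest one, all its plots are of this kind ([free_plot_lbs]).
      But p(t) has at least N points in its support as soon as 0 < t < 1/(N+1)
      ([witness_dom]). *)

(** * Smooth functions of one variable *)

Section Flat.
Context {R : realType}.
Implicit Types (g q : R -> R) (c : nat -> R) (t : R).

(** Asking for some derivative at each stage lets closure properties be proved
    by exhibiting it, without extensionality for iterated derivatives. *)
Fixpoint ntimes_derivable k q : Prop :=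
  if k is k'.+1 then exists2 q' : R -> R,
    (forall t, is_derive t 1 q (q' t)) & ntimes_derivable k' q'
  else True.

Lemma ntimes_derivable_cst k (a : R) : ntimes_derivable k (fun=> a).
Proof.
by elim: k a => // k IHk a; exists (fun=> 0) => // t; exact: is_derive_cst.
Qed.

Lemma diff_coord1 (x v : 'rV[R]_1) :
  'd (fun M : 'rV[R]_1 => M ord0 ord0) x v = v ord0 ord0.
Proof.
rewrite -deriveE; last exact: differentiable_coord.
have := @derive_mx R 'rV[R]_1 1 1 id x v (@derivable_id _ _ x v).
by rewrite derive_id => /matrixP/(_ ord0 ord0); rewrite mxE => ->.
Qed.

(** One extra derivative on the line pays for the continuity required at the
    last stage of [Ck]. *)
Lemma Ck_coord1 k (q : R -> R) :
  ntimes_derivable k.+1 q -> Ck k setT (fun x : 'rV[R]_1 => q (x ord0 ord0)).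
Proof.
elim: k q => [|k IHk] q [q' dq Cq'].
  move=> x _; apply: (@continuous_comp _ _ _ (fun M : 'rV[R]_1 => M ord0 ord0) q).
    exact: coord_continuous.
  have dx := dq (x ord0 ord0).
  by apply/differentiable_continuous/derivable1_diffP.
have dqc x : differentiable (fun M : 'rV[R]_1 => q (M ord0 ord0)) x.
  apply: (@differentiable_comp _ _ _ _ (fun M : 'rV[R]_1 => M ord0 ord0) q).
    exact: differentiable_coord.
  have dx := dq (x ord0 ord0).
  by apply/derivable1_diffP.
split=> [x _|v]; first exact: dqc.
apply: (Ck_ext (f := fun x => v ord0 ord0 * q' (x ord0 ord0))).
- exact: openT.
- move=> x _; have dx := dq (x ord0 ord0).
  rewrite deriveE //.
  rewrite (@diff_comp _ _ _ _ (fun M : 'rV[R]_1 => M ord0 ord0) q) //=;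
    last 2 first.
  + exact: differentiable_coord.
  + by apply/derivable1_diffP.
  rewrite diff_coord1.
  rewrite diff1E; last by apply/derivable1_diffP.
  by rewrite derive1E derive_val.
- apply: CkM; [exact: openT|exact: Ck_cst|exact: IHk].
Qed.

(** * Functions with at most a pole at 0, together with their derivatives *)

Definition pole_bounded g : Prop :=
  exists C m, forall t, 0 < t <= 1 -> `|g t| <= C * t^-1 ^+ m.

(** A class stable under sums and products and containing 1/t, so that the
    derivative of e g for e(t) = exp(-1/t), namely e (g' + g / t^2), is again
    of the form e h with h in the class. *)
Fixpoint moderate k g : Prop :=
  pole_bounded g /\
  if k is k'.+1 then exists2 g' : R -> R,
    (forall t, 0 < t -> is_derive t 1 g (g' t)) & moderate k' g'
  else True.

Lemma pole_bounded_ge0 g C m :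
  (forall t, 0 < t <= 1 -> `|g t| <= C * t^-1 ^+ m) -> 0 <= C.
Proof.
move=> /(_ 1); rewrite ltr01 lexx invr1 expr1n mulr1 => /(_ isT).
exact: le_trans.
Qed.

Lemma moderateE k g : moderate k g -> pole_bounded g.
Proof. by case: k => [|k] []. Qed.

Lemma moderateW k g : moderate k.+1 g -> moderate k g.
Proof.
elim: k g => [|k IHk] g [g0 [g' dg Mg']]; split=> //.
by exists g' => //; exact: IHk.
Qed.

Lemma moderate_cst k (a : R) : moderate k (fun=> a).
Proof.
elim: k a => [|k IHk] a; (split; first by
  exists `|a|, 0%N => t _; rewrite expr0 mulr1) => //.
by exists (fun=> 0) => // t _; exact: is_derive_cst.
Qed.

Lemma moderateD k g h :
  moderate k g -> moderate k h -> moderate k (fun t => g t + h t).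
Proof.
have D0 g1 h1 : pole_bounded g1 -> pole_bounded h1 ->
    pole_bounded (fun t => g1 t + h1 t).
  move=> [C [m gC]] [D [n hD]]; exists (C + D), (m + n)%N => t t01.
  have C0 := pole_bounded_ge0 gC; have D0 := pole_bounded_ge0 hD.
  have t1 : 1 <= t^-1 by case/andP: t01 => t0 t1; rewrite invf_ge1.
  rewrite (le_trans (ler_normD _ _)) // mulrDl lerD //.
  - by rewrite (le_trans (gC t t01)) // ler_wpM2l // ler_weXn2l // leq_addr.
  - by rewrite (le_trans (hD t t01)) // ler_wpM2l // ler_weXn2l // leq_addl.
elim: k g h => [|k IHk] g h [g0 Mg] [h0 Mh]; (split; first exact: D0) => //.
have [g' dg Mg'] := Mg; have [h' dh Mh'] := Mh.
exists (fun t => g' t + h' t); last exact: IHk.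
by move=> t t0; apply: is_deriveD; [exact: dg|exact: dh].
Qed.

Lemma moderateM k g h :
  moderate k g -> moderate k h -> moderate k (fun t => g t * h t).
Proof.
have M0 g1 h1 : pole_bounded g1 -> pole_bounded h1 ->
    pole_bounded (fun t => g1 t * h1 t).
  move=> [C [m gC]] [D [n hD]]; exists (C * D), (m + n)%N => t t01.
  by rewrite normrM exprD mulrACA ler_pM // ?gC ?hD.
elim: k g h => [|k IHk] g h Mg Mh.
  by split=> //; apply: M0; [exact: moderateE Mg|exact: moderateE Mh].
split; first by apply: M0; [exact: moderateE Mg|exact: moderateE Mh].
have [_ [g' dg Mg']] := Mg; have [_ [h' dh Mh']] := Mh.
exists (fun t => g t * h' t + h t * g' t).
  by move=> t t0; apply: is_deriveM; [exact: dg|exact: dh].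
by apply: moderateD; apply: IHk => //; exact: moderateW.
Qed.

Lemma moderateV k : moderate k (fun t => t^-1).
Proof.
have V0 : pole_bounded (fun t => t^-1).
  exists 1, 1%N => t /andP[t0 _].
  by rewrite mul1r expr1 ger0_norm // invr_ge0 ltW.
elim: k => [|k IHk]; split=> //.
exists (fun t => -1 * (t^-1 * t^-1)).
  move=> t t0; apply: is_derive_eq.
    by apply: (@is_deriveV _ id); rewrite ?gt_eqF.
  by rewrite /= /GRing.scale /= mulr1 mulN1r -expr2 exprVn.
by apply: moderateM; [exact: moderate_cst|exact: moderateM].
Qed.

(** * The flat function exp(-1/t) *)

Definition flat t : R := if 0 < t then expR (- t^-1) else 0.

Lemma flat_gt0 t : 0 < t -> 0 < flat t.
Proof. by rewrite /flat => ->; exact: expR_gt0. Qed.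

Lemma flat_le0 t : t <= 0 -> flat t = 0.
Proof. by rewrite /flat leNgt => /negbTE ->. Qed.

Lemma flat0 : flat 0 = 0.
Proof. exact: flat_le0. Qed.

(** exp(1/t) exceeds t^-(m+2) / (m+2)!, so that flatness beats a pole of any
    order.  The exponent 2 gives differentiability at 0, with derivative 0. *)
Lemma flat_bound g : pole_bounded g ->
  exists2 K : R, 0 < K & forall t, t <= 1 -> `|flat t * g t| <= K * t ^+ 2.
Proof.
move=> [C [m gC]].
have C0 := pole_bounded_ge0 gC.
exists ((m.+2)`!%:R * (C + 1)).
  by rewrite mulr_gt0 ?ltr0n ?fact_gt0 // ltr_wpDl.
move=> t t1; have [t0|t0] := leP t 0.
  rewrite flat_le0 // mul0r normr0 mulr_ge0 ?sqr_ge0 //.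
  by rewrite mulr_ge0 ?ler0n // addr_ge0.
rewrite normrM (gtr0_norm (flat_gt0 t0)) /flat t0.
have e_le : expR (- t^-1) <= (m.+2)`!%:R * t ^+ m.+2.
  have fp : 0 < (m.+2)`!%:R * t ^+ m.+2 :> R.
    by rewrite mulr_gt0 ?exprn_gt0 // ltr0n fact_gt0.
  rewrite expRN -[leRHS]invrK lef_pV2 ?posrE ?expR_gt0 ?invr_gt0 //.
  have := @expR_ge1Dxn R t^-1 m.+1; rewrite invr_ge0 (ltW t0) => /(_ isT).
  by rewrite invfM mulrC exprVn; apply: le_trans; rewrite lerDr.
have := gC t; rewrite t0 t1 => /(_ isT) gt.
apply: (le_trans (ler_pM (expR_ge0 _) (normr_ge0 _) e_le gt)).
have tn0 : t ^+ m != 0 by rewrite expf_neq0 // gt_eqF.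
have -> : (m.+2)`!%:R * t ^+ m.+2 * (C * t^-1 ^+ m) = (m.+2)`!%:R * C * t ^+ 2.
  by rewrite -[in t ^+ _]add2n exprD exprVn; field.
by rewrite ler_wpM2r ?sqr_ge0 // ler_wpM2l // lerDl.
Qed.

(** The product rule on t > 0, extended by 0 to t <= 0 thanks to [flat_bound]. *)
Lemma is_derive_flat g (g' : R -> R) : pole_bounded g ->
  (forall t, 0 < t -> is_derive t 1 g (g' t)) ->
  forall t, is_derive t 1 (fun t => flat t * g t)
                          (flat t * (g' t + t^-1 * t^-1 * g t)).
Proof.
move=> Mg dg t; have [t0|t0|->] := ltgtP t 0.
- rewrite (flat_le0 (ltW t0)) mul0r.
  apply: (near_eq_is_derive _ (is_derive_cst 0 t 1)).
  near=> s; rewrite /= flat_le0 ?mul0r //.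
  by apply: ltW; near: s; exact: lt_nbhsl.
- have dgt := dg t t0.
  have dV : is_derive t 1 (fun s : R => - s^-1) (t^-1 * t^-1).
    apply: is_derive_eq.
      by apply: is_deriveN; apply: (@is_deriveV _ id); rewrite ?gt_eqF.
    by rewrite /= /GRing.scale /= mulr1 opprK -expr2 exprVn.
  have dE : is_derive t 1 ((expR \o (fun s : R => - s^-1)) * g)
      (flat t * (g' t + t^-1 * t^-1 * g t)).
    apply: is_derive_eq.
    by rewrite /= /flat t0 /GRing.scale /=; ring.
  apply: near_eq_is_derive dE.
  near=> s; rewrite fctE /= /flat ifT //.
  by near: s; exact: lt_nbhsr.
(* At 0 the slope of t |-> flat t * g t is at most K |t|. *)
- rewrite flat0 mul0r; apply/is_derive1_caratheodory.
  have [K K0 Kb] := flat_bound Mg.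
  exists (fun z => flat z * g z / z); split.
  + move=> z; rewrite flat0 mul0r !subr0.
    have [->|z0] := eqVneq z 0; first by rewrite mulr0 flat0 mul0r.
    by rewrite divfK.
  + rewrite /prop_for /continuous_at flat0 !mul0r.
    apply/cvgr0Pnorm_le => _/posnumP[eps].
    have nK : \forall z \near (0 : R), `|z| <= eps%:num / K.
      by apply: nbhs0_le; rewrite divr_gt0.
    near=> z.
    have z1 : z <= 1 by apply: ltW; near: z; exact: lt_nbhsl.
    have [->|z0] := eqVneq z 0; first by rewrite flat0 !mul0r normr0.
    have zn0 : 0 < `|z| by rewrite normr_gt0.
    rewrite normrM normfV ler_pdivrMr //.
    apply: (le_trans (Kb z z1)).
    rewrite -[z ^+ 2]ger0_norm ?sqr_ge0 // normrX expr2 mulrA ler_wpM2r //.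
    rewrite mulrC -ler_pdivlMr //.
    by near: z; exact: nK.
  + by rewrite invr0 mulr0.
Unshelve. all: by end_near.
Qed.

Lemma ntimes_derivable_flat k g :
  moderate k g -> ntimes_derivable k (fun t => flat t * g t).
Proof.
elim: k g => // k IHk g Mg; have [g0 [g' dg Mg']] := Mg.
exists (fun t => flat t * (g' t + t^-1 * t^-1 * g t)).
  exact: is_derive_flat.
apply: IHk; apply: moderateD => //; apply: moderateM; last exact: moderateW.
by apply: moderateM; exact: moderateV.
Qed.

(** * Superposition of translated flat functions *)

Definition steps t : nat := (Num.truncn t^-1).+1.

Lemma steps_gt t : 0 < t -> t^-1 < (steps t)%:R.
Proof.
by move=> t0; have /andP[] := truncn_itv (ltW (etrans (invr_gt0 t) t0)).
Qed.

(** For t > 0 and q vanishing on negative numbers, this is the infinite sum of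
    the c_n q(1/(n+1) - t), whose terms of index at least [steps t] are 0. *)
Definition cascade c q t : R :=
  \sum_(0 <= n < steps t) c n * q (n.+1%:R^-1 - t).

Lemma cascadeE c q t (M : nat) : (forall s : R, s <= 0 -> q s = 0) ->
  0 < t -> t^-1 <= M%:R ->
  cascade c q t = \sum_(0 <= n < M) c n * q (n.+1%:R^-1 - t).
Proof.
move=> q0 t0.
have stable (M1 M2 : nat) : (M1 <= M2)%N -> t^-1 <= M1%:R ->
    \sum_(0 <= n < M1) c n * q (n.+1%:R^-1 - t) =
    \sum_(0 <= n < M2) c n * q (n.+1%:R^-1 - t).
  move=> M12 tM1; rewrite (big_cat_nat (leq0n M1) M12) /=.
  rewrite [X in _ + X]big_nat_cond [X in _ + X]big1 ?addr0 //.
  move=> n /andP[/andP[M1n _] _]; rewrite q0 ?mulr0 // subr_le0.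
  rewrite -[leRHS]invrK lef_pV2 ?posrE ?invr_gt0 ?ltr0n //.
  by rewrite (le_trans tM1) // ler_nat leqW.
move=> tM; have [MN|NM] := leqP M (steps t).
  by rewrite /cascade -(stable M).
by rewrite /cascade (stable _ _ (ltnW NM)) // ltW // steps_gt.
Qed.

(** The number of terms varies with t, but around t it can be taken constant,
    equal to the number needed at t / 2. *)
Lemma is_derive_cascade c q (q' : R -> R) t :
  (forall s : R, s <= 0 -> q s = 0) -> (forall s : R, s <= 0 -> q' s = 0) ->
  (forall s : R, is_derive s 1 q (q' s)) -> 0 < t ->
  is_derive t 1 (cascade c q) (cascade (fun n => - c n) q' t).
Proof.
move=> q0 q'0 dq t0; pose M := steps (t / 2).
have t20 : 0 < t / 2 by rewrite divr_gt0.
have tM s : t / 2 <= s -> s^-1 <= M%:R.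
  move=> ts; rewrite (le_trans _ (ltW (steps_gt t20))) // lef_pV2 ?posrE //.
  exact: lt_le_trans ts.
have t2t : t / 2 < t by rewrite ltr_pdivrMr // ltr_pMr // ltr1n.
have dS : is_derive t 1 (\sum_(n < M) (fun s : R => c n * q (n.+1%:R^-1 - s)))
    (cascade (fun n => - c n) q' t).
  rewrite (cascadeE _ q'0 t0 (tM _ (ltW t2t))) big_mkord.
  apply: is_derive_sum => n.
  have dr : is_derive t 1 (fun s : R => n.+1%:R^-1 - s) (- 1).
    have := is_deriveB (is_derive_cst (n.+1%:R^-1 : R) t 1) (is_derive_id t 1).
    by rewrite sub0r.
  have dqn := dq (n.+1%:R^-1 - t).
  have dqc := @is_derive1_comp _ q (fun s : R => n.+1%:R^-1 - s) t _ _ dqn dr.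
  have dz := is_deriveM (is_derive_cst (c n) t 1) dqc.
  apply: (is_derive_eq dz).
  by rewrite /GRing.scale /= mulr0 addr0 mulrN1 mulrN mulNr.
apply: near_eq_is_derive dS.
near=> s; have ts : t / 2 < s by near: s; exact: lt_nbhsr.
rewrite (cascadeE _ q0 (lt_trans t20 ts) (tM _ (ltW ts))) big_mkord.
by rewrite fct_sumE.
Unshelve. all: by end_near.
Qed.

(** The terms are bounded uniformly in n and t, and there are at most 1/t + 1 of
    them, so they add up to O(1/t); the derivative is a sum of the same kind. *)
Lemma moderate_cascade k c g :
  (exists B, forall n, `|c n| <= B) -> moderate k g ->
  moderate k (cascade c (fun s => flat s * g s)).
Proof.
have q0 (h : R -> R) s : s <= 0 -> flat s * h s = 0.
  by move=> s0; rewrite flat_le0 // mul0r.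
have C0 c1 g1 : (exists B, forall n, `|c1 n| <= B) -> pole_bounded g1 ->
    pole_bounded (cascade c1 (fun s => flat s * g1 s)).
  move=> [B cB] Mg; have [K K0 Kb] := flat_bound Mg.
  have B0 : 0 <= B by have := cB 0%N; apply: le_trans.
  exists (B * K * 2), 1%N => t /andP[t0 t1].
  have t1V : 1 <= t^-1 by rewrite invf_ge1.
  rewrite (le_trans (ler_norm_sum _ _ _)) //.
  apply: (@le_trans _ _ (\sum_(0 <= n < steps t) (B * K))).
    apply: ler_sum => n _; rewrite normrM ler_pM //.
    set s := _ - t; have [s0|s0] := leP s 0.
      by rewrite q0 // normr0 ltW.
    have s1 : s <= 1.
      rewrite lerBlDr (@le_trans _ _ 1) ?lerDl ?(ltW t0) //.
      by rewrite invf_le1 ?ler1n.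
    by rewrite (le_trans (Kb _ s1)) // ler_piMr ?(ltW K0) // expr_le1 // ltW.
  rewrite big_const_nat iter_addr_0 subn0.
  rewrite -[leLHS]mulr_natr -[leRHS]mulrA ler_wpM2l //.
    by rewrite mulr_ge0 // ltW.
  rewrite expr1 /steps -natr1 mulr_natl mulr2n lerD //.
  by rewrite truncn_le (le_trans _ t1V).
elim: k c g => [|k IHk] c g cb Mg.
  by split=> //; apply: C0 => //; exact: moderateE Mg.
split; first by apply: C0 => //; exact: moderateE Mg.
have [g0 [g' dg Mg']] := Mg.
exists (cascade (fun n => - c n) (fun s => flat s * (g' s + s^-1 * s^-1 * g s))).
  move=> t t0; apply: is_derive_cascade => //; [exact: q0|exact: q0|].
  exact: is_derive_flat.
apply: IHk.
  have [B cB] := cb; exists B => n.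
  by rewrite normrN.
apply: moderateD => //; apply: moderateM; last exact: moderateW.
by apply: moderateM; exact: moderateV.
Qed.

End Flat.

(** * Maps with locally bounded support *)

Section Support.
Context {R : realType}.
Definition locally_bounded_support (X : choiceType) n (U : set 'rV[R]_n)
    (p : 'rV[R]_n -> {freeg X / R}) : Prop :=
  open U /\ forall x, U x ->
    exists N, \forall y \near x, (size (dom (p y)) <= N)%N.

Context {X : choiceType}.

Lemma lbs_open n (U : set 'rV[R]_n) (p : 'rV[R]_n -> {freeg X / R}) :
  locally_bounded_support U p -> open U.
Proof. by case. Qed.

Lemma lbs_ext n (U : set 'rV[R]_n) (p q : 'rV[R]_n -> {freeg X / R}) :
  (forall x, U x -> p x = q x) ->
  locally_bounded_support U p -> locally_bounded_support U q.
Proof.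
move=> pq [oU bp]; split=> // x Ux; have [N pN] := bp x Ux; exists N.
near=> y; rewrite -pq; first by near: y.
by near: y; exact: open_nbhs_nbhs.
Unshelve. all: by end_near.
Qed.

Lemma lbs_cst n (U : set 'rV[R]_n) (a : {freeg X / R}) :
  open U -> locally_bounded_support U (fun=> a).
Proof.
by move=> oU; split=> // x _; exists (size (dom a)); near=> y.
Unshelve. all: by end_near.
Qed.

Lemma lbs_comp m n (V : set 'rV[R]_m) (U : set 'rV[R]_n) g
    (p : 'rV[R]_n -> {freeg X / R}) :
  open V -> smooth_on V g -> (forall x, V x -> U (g x)) ->
  locally_bounded_support U p -> locally_bounded_support V (p \o g).
Proof.
move=> oV sg gU [oU bp]; split=> // x Vx; have [N pN] := bp _ (gU x Vx).
have cg : {for x, continuous g} := sg 0%N x Vx.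
by exists N; exact: cg pN.
Qed.

Lemma lbs_cover n (I : Type) (U_ : I -> set 'rV[R]_n)
    (p : 'rV[R]_n -> {freeg X / R}) :
  (forall i, locally_bounded_support (U_ i) p) ->
  locally_bounded_support (\bigcup_i U_ i) p.
Proof.
move=> bp; split; first by apply: bigcup_open => i _; have [] := bp i.
by move=> x [i _ Ux]; have [_] := bp i; exact.
Qed.

Definition lbs_diffeology : diffeology R {freeg X / R} :=
  Diffeology lbs_open lbs_ext lbs_cst lbs_comp lbs_cover.

(** The support of a sum lies in the union of the supports, and scaling does not
    enlarge the support. *)
Lemma lbs_is_dvs : is_dvs lbs_diffeology.
Proof.
split=> n U p [p1 p2].
  have [oU b1] := p1; have [_ b2] := p2; split=> // x Ux.
  have [N1 pN1] := b1 x Ux; have [N2 pN2] := b2 x Ux; exists (N1 + N2)%N.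
  near=> y; rewrite /=.
  apply: (@leq_trans (size (dom (p y).1 ++ dom (p y).2))).
    exact: uniq_leq_size (uniq_dom _) (@domD_subset _ _ _ _).
  by rewrite size_cat leq_add //; near: y.
have [oU b2] := p2; split=> // x Ux; have [N pN] := b2 x Ux; exists N.
near=> y; apply: (@leq_trans (size (dom (p y).2))); last by near: y.
apply: uniq_leq_size (uniq_dom _) _ => z; rewrite !mem_dom /=.
by rewrite [coeff _ _]coeff_fgscale; apply: contra_neq => ->; rewrite mulr0.
Unshelve. all: by end_near.
Qed.

Lemma free_plot_lbs (DX : diffeology R X) n (U : set 'rV[R]_n) p :
  plot (free_diffeology DX) U p -> locally_bounded_support U p.
Proof.
apply: (@free_diffeology_min _ _ _ lbs_diffeology); first exact: lbs_is_dvs.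
move=> m V q /plot_open oV; split=> // x _; exists 1%N; near=> y.
by rewrite /= /free_unit domU1.
Unshelve. all: by end_near.
Qed.

End Support.

(** * A curve that linear functionals find smooth but is not a plot *)

Section Witness.
Context {R : realType}.

Definition witness (x : 'rV[R]_1) : {freeg R / R} :=
  let t := x ord0 ord0 in
  flat t *: \sum_(0 <= n < steps t) flat (n.+1%:R^-1 - t) *: << n.+1%:R^-1 >>.

(** The smooth function f underlying l is continuous at 0, so its values at the
    points 1/(n+1) are bounded. *)
Lemma witness_smooth (l : {scalar {freeg R / R}}) :
  dsmooth (free_diffeology (real_diffeology R)) (real_diffeology R) l ->
  smooth_on setT (l \o witness).
Proof.
move=> sl k.
pose f (s : R) : R := l << s >>.
have cf : {for 0, continuous f}.
  have px : plot (real_diffeology R) setT (fun x : 'rV[R]_1 => x ord0 ord0).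
    split; first exact: openT.
    move=> j; apply: (@Ck_coord1 _ _ id).
    exists (fun=> 1); first by move=> t; exact: is_derive_id.
    exact: ntimes_derivable_cst.
  have [_ /(_ 0%N) sf] := sl _ _ _ (free_unit_smooth px).
  have -> : f = (l \o (free_unit (R := R) (X := R) \o
                        (fun x : 'rV[R]_1 => x ord0 ord0))) \o
                (fun s : R => s *: const_mx 1).
    by apply/funext => s; rewrite /= !mxE mulr1.
  apply: continuous_comp; last exact: sf.
  exact: scalel_continuous.
pose c n := f n.+1%:R^-1.
have cb : exists B, forall n, `|c n| <= B.
  have /cvg_seq_bounded/pinfty_ex_gt0[B _ cB] : cvgn c.
    apply/cvg_ex; exists (f 0).
    exact: (cvg_comp _ _ cvg_harmonic cf).
  by exists B => n; exact: cB.
(* The factor 1 presents flat itself as flat times a moderate function. *)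
pose G := cascade c (fun s => flat s * 1).
have -> : l \o witness = (fun x => flat (x ord0 ord0) * G (x ord0 ord0)).
  apply/funext => x; rewrite /= /witness linearZ /= raddf_sum /=; congr (_ * _).
  by apply: eq_bigr => n _; rewrite linearZ /= mulr1 mulrC.
apply: (@Ck_coord1 _ k (fun s => flat s * G s)); apply: ntimes_derivable_flat.
by apply: moderate_cascade => //; exact: moderate_cst.
Qed.

(** The points 1/(n+1) with n < N all exceed t, and their coefficients
    flat t * flat (1/(n+1) - t) are positive. *)
Lemma witness_dom (t : R) (N : nat) : 0 < t -> t < N.+1%:R^-1 ->
  (N <= size (dom (witness (const_mx t))))%N.
Proof.
move=> t0 tN.
have inj : injective (fun n : nat => n.+1%:R^-1 : R).
  by move=> m n /invr_inj/eqP; rewrite eqr_nat => /eqP[].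
rewrite -[X in (X <= _)%N](size_iota 0) -(size_map (fun n => n.+1%:R^-1 : R)).
apply: uniq_leq_size; first by rewrite map_inj_uniq ?iota_uniq.
move=> _ /mapP[n + ->]; rewrite mem_iota /= add0n => nN.
have tn : t < n.+1%:R^-1.
  by rewrite (lt_trans tN) // ltf_pV2 ?posrE ?ltr0n // ltr_nat ltnS.
have ns : (n < steps t)%N.
  rewrite -(ltr_nat R) (lt_trans _ (steps_gt t0)) //.
  rewrite (@lt_trans _ _ n.+1%:R) ?ltr_nat //.
  by rewrite -[ltLHS]invrK ltf_pV2 ?posrE ?invr_gt0 ?ltr0n.
rewrite mem_dom /witness !mxE [coeff _ _]coeff_fgscale raddf_sum /= big_mkord.
rewrite (bigD1 (Ordinal ns)) //= [X in _ + X]big1 => [|i ni].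
  rewrite addr0 [coeff _ _]coeff_fgscale coeffU eqxx !mulr1.
  by rewrite mulf_neq0 // gt_eqF // flat_gt0 // subr_gt0.
rewrite [coeff _ _]coeff_fgscale coeffU (inj_eq inj) mul1r.
by rewrite (_ : (i == n :> nat) = false) ?mulr0 //; apply: negbTE.
Qed.

End Witness.

Theorem proposition3p33 (R : realType) :
  ~ in_DV (free_dvs (real_diffeology R)).
Proof.
move=> dv; have [_] := dv 1%N setT witness openT.
move=> /(_ witness_smooth)/free_plot_lbs[_ /(_ 0 I)[N bN]].
have cmx :
  (fun t : R => t *: const_mx 1 : 'rV[R]_1) t @[t --> 0] --> (0 : 'rV[R]_1).
  rewrite -[X in _ --> X](scale0r (const_mx 1)); exact: scalel_continuous.
have [e /= e0 eb] := cmx _ bN.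
(* N.+2 makes the support have at least N.+1 points, against the bound N. *)
pose t := Num.min (e / 2) (N.+2%:R^-1 / 2).
have t0 : 0 < t by rewrite lt_min !divr_gt0 // invr_gt0.
have te : t < e by rewrite gt_min ltr_pdivrMr // ltr_pMr // ltr1n.
have tN : t < N.+2%:R^-1.
  by rewrite gt_min [X in _ || X]ltr_pdivrMr // ltr_pMr ?invr_gt0 // ltr1n orbT.
have := eb t; rewrite /= sub0r normrN gtr0_norm // => /(_ te).
rewrite leqNgt; apply/negP/negPn.
have -> : t *: const_mx 1 = const_mx t :> 'rV[R]_1.
  by apply/matrixP => i j; rewrite !mxE mulr1.
exact: witness_dom.
Qed.
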